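(* Let $q$ be a power of a prime $p$, let $0\le j\le q-2$ and $n\ge1$ be integers, and put $k=2j+2+(n-1)(q-1)$ and $m\equiv j+1\pmod{q-1}$. The smallest possible slope for the Atkin operator $\mathbf{U}_t$ acting on $S^1_{k,m}(\Gamma_0(t))$ is $j+1$ (i.e. every slope $\alpha$ satisfies $\alpha\ge j+1$), and moreover its multiplicity satisfies $$d(j+1,k)\le1.$$
   Context: $K_\infty$ is the completion of $\mathbb{F}_q(t)$ at $\infty=1/t$, $\mathbb{C}_\infty$ is the completion of an algebraic closure of $K_\infty$, $\Omega=\mathbb{P}^1(\mathbb{C}_\infty)-\mathbb{P}^1(K_\infty)$. $\Gamma_0(t)=\{\begin{pmatrix}a&b\\c&d\end{pmatrix}\in GL_2(\mathbb{F}_q[t]):c\equiv0\bmod t\}$. $S^1_{k,m}(\Gamma_0(t))$ is the space of Drinfeld cusp forms of weight $k$ and type $m$: rigid analytic $\varphi:\Omega\to\mathbb{C}_\infty$ with $\varphi(\gamma z)(\det\gamma)^m(cz+d)^{-k}=\varphi(z)$ for all $\gamma=\begin{pmatrix}a&b\\c&d\end{pmatrix}\in\Gamma_0(t)$, holomorphic and vanishing at all cusps. $\mathbf{U}_t(\varphi)(z)=\sum_{b\in\mathbb{F}_q}\varphi\left(\frac{z+b}{t}\right)$. For $k,j,n,m$ as in the claim, $S^1_{k,m}(\Gamma_0(t))$ has dimension $n$ and in a suitable basis (of harmonic cocycles) $\mathbf{U}_t$ has matrix $MD$, where $M=(m_{a,b})_{1\le a,b\le n}$ has entries in $\mathbb{F}_p$,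 $m_{a,b}=-\left[\binom{j+(n-a)(q-1)}{j+(n-b)(q-1)}+(-1)^{j+1}\binom{j+(n-a)(q-1)}{j+(b-1)(q-1)}\right]$ if $a\ne b$, $m_{a,a}=(-1)^j\binom{j+(n-a)(q-1)}{j+(a-1)(q-1)}$ (with $\binom{x}{y}=0$ if $y>x$), and $D=\mathrm{diag}(t^{s_1},\dots,t^{s_n})$ with $s_i=j+1+(i-1)(q-1)$. Slopes: the characteristic polynomial $P_{\mathbf{U}_t}(X)$ of $\mathbf{U}_t$ on $S^1_{k,m}(\Gamma_0(t))$ has coefficients in $\mathbb{F}_q[t]$; let $v_t$ be the $t$-adic valuation ($v_t(t)=1$), extended to an algebraic closure of $\mathbb{F}_q((t))$. For $\alpha\in\mathbb{Q}$, $d(\alpha,k)$ is the number of roots of $P_{\mathbf{U}_t}(X)$, counted with multiplicity, of $t$-adic valuation $\alpha$; $\alpha$ is a slope (of multiplicity $d(\alpha,k)$) if $d(\alpha,k)\ge1$. The root $0$ does not contribute a slope. *)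

(* Defs.v *)
From HB Require Import structures.
From mathcomp Require Import all_boot all_order all_algebra.
From mathcomp Require Import constructive_ereal.

Set Implicit Arguments.
Unset Strict Implicit.
Unset Printing Implicit Defensive.

Import Order.TTheory GRing.Theory Num.Theory.

Local Open Scope ring_scope.

(* All absolute values are written additively, |x| = q^(- v x), with v taking *)
(* values in rat extended by +oo = v 0.  The values of 1/t- and t-adic        *)
(* valuations on algebraic closures, and on completions of these, are         *)
(* rational, so rat loses nothing.                                            *)
Record is_valuation (K : fieldType) (v : K -> \bar rat) : Prop := {
  val_eqy : forall x, (v x == +oo%E) = (x == 0);
  val_neqNy : forall x, v x != -oo%E;
  valM : forall x y, v (x * y) = (v x + v y)%E;
  valD : forall x y, (Order.min (v x) (v y) <= v (x + y)%R)%E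
}.

Definition vconverges (K : fieldType) (v : K -> \bar rat) (u : nat -> K) (l : K) :=
  forall a : rat, exists N : nat, forall n : nat, (N <= n)%N ->
    (a%:E <= v (u n - l)%R)%E.

Definition vcauchy (K : fieldType) (v : K -> \bar rat) (u : nat -> K) :=
  forall a : rat, exists N : nat, forall m n : nat, (N <= m)%N -> (N <= n)%N ->
    (a%:E <= v (u m - u n)%R)%E.

Record completion (K : fieldType) (v : K -> \bar rat) := Completion {
  compl_sort :> fieldType;
  compl_val : compl_sort -> \bar rat;
  compl_emb : {rmorphism K -> compl_sort};
  compl_valuation : is_valuation compl_val;
  compl_extends : forall x, compl_val (compl_emb x) = v x;
  compl_dense : forall (y : compl_sort) (a : rat),
    exists x, (a%:E <= compl_val (y - compl_emb x)%R)%E;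
  compl_complete : forall u, vcauchy compl_val u ->
    exists l, vconverges compl_val u l
}.

(* An algebraic closure of K together with an extension of v to it; this      *)
(* extension is unique when K is complete.                                    *)
Record valued_algclosure (K : fieldType) (v : K -> \bar rat) := ValuedAlgClosure {
  aclos_sort :> closedFieldType;
  aclos_val : aclos_sort -> \bar rat;
  aclos_emb : {rmorphism K -> aclos_sort};
  aclos_valuation : is_valuation aclos_val;
  aclos_extends : forall x, aclos_val (aclos_emb x) = v x;
  aclos_algebraic : forall y, algebraicOver aclos_emb y
}.

(* For w additive on products of nonzero elements, w a - w b at a / b. *)
Definition frac_val (A : idomainType) (w : A -> int) (x : {fraction A}) : \bar rat :=
  if x == 0 then +oo%E else ((w \n_(repr x) - w \d_(repr x))%:~R)%:E.

Lemma frac_valE (A : idomainType) (w : A -> int) (a b : A) :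
    (forall x y : A, x != 0 -> y != 0 -> w (x * y) = w x + w y) ->
    a != 0 -> b != 0 ->
  frac_val w (FracField.tofrac a / FracField.tofrac b) = ((w a - w b)%:~R)%:E.
Proof.
move=> wM a0 b0; rewrite /frac_val mulf_eq0 invr_eq0 !tofrac_eq0.
rewrite (negPf a0) (negPf b0) /=.
set x := _ / _; set r := repr x.
have d0 : \d_r != 0 by apply: denom_ratioP.
have xE : FracField.tofrac \n_r = x * FracField.tofrac \d_r.
  rewrite -{1}[x]reprK -/r; unlock FracField.tofrac.
  rewrite -[RHS]FracField.pi_mul /FracField.mulf.
  rewrite !numden_Ratio ?oner_eq0 // mulr1; apply/eqmodP.
  by rewrite /= FracField.equivfE !numden_Ratio ?oner_eq0 // mul1r.
have eqn : a * \d_r = \n_r * b.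
  apply/eqP; rewrite -tofrac_eq !tofracM xE /x mulrAC divfK ?tofrac_eq0 //.
have n0 : \n_r != 0.
  by apply: contra_neq (mulf_neq0 a0 d0) => n0; rewrite eqn n0 mul0r.
have := congr1 w eqn; rewrite !wM // => e.
by congr ((_%:~R)%:E); apply/eqP; rewrite subr_eq addrAC eq_sym subr_eq e.
Qed.

Definition vinf (F : finFieldType) : {fraction {poly F}} -> \bar rat :=
  frac_val (fun a : {poly F} => - (size a).-1%:Z).

Definition vt (F : finFieldType) : {fraction {poly F}} -> \bar rat :=
  frac_val (fun a : {poly F} => (mup 0 a)%:Z).

(* C_oo, as the top of a tower F(t) -> K_oo -> algebraic closure -> C_oo.  *)
Record Cinfty (F : finFieldType) := CInfty {
  Kinf : completion (@vinf F);
  Kinfbar : valued_algclosure (@compl_val _ _ Kinf);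
  Cinf :> completion (@aclos_val _ _ Kinfbar)
}.

(* An algebraic closure of F((t)), F((t)) being the t-adic completion of F(t). *)
Record tadic_closure (F : finFieldType) := TadicClosure {
  Laurent : completion (@vt F);
  Laurentbar :> valued_algclosure (@compl_val _ _ Laurent)
}.

Definition tadic_emb (F : finFieldType) (L : tadic_closure F) (a : {poly F}) : L :=
  aclos_emb L (compl_emb (Laurent L) (FracField.tofrac a)).

Section CuspForms.
Context {F : finFieldType} {C : Cinfty F}.

Definition emb_Kinf (x : Kinf C) : C := compl_emb C (aclos_emb (Kinfbar C) x).

Definition emb_poly (a : {poly F}) : C :=
  emb_Kinf (compl_emb (Kinf C) (FracField.tofrac a)).

Let v : C -> \bar rat := @compl_val _ _ C.

Definition Omega (z : C) : Prop := forall x : Kinf C, z <> emb_Kinf x.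

(* |z| <= q^n and |z - x| >= q^(-n) for all x in K_oo.  These affinoids form  *)
(* an admissible covering of Omega.                                           *)
Definition Omega_affinoid (n : nat) (z : C) : Prop :=
  ((- n%:R)%R%:E <= v z)%E /\ forall x : Kinf C, (v (z - emb_Kinf x)%R <= n%:R%R%:E)%E.

(* On each affinoid of the covering, phi is a uniform limit of rational       *)
(* functions without poles there.                                             *)
Definition rigid_analytic (phi : C -> C) : Prop :=
  forall (n : nat) (a : rat), exists f g : {poly C},
    (forall z, Omega_affinoid n z -> g.[z] != 0) /\
    (forall z, Omega_affinoid n z -> (a%:E <= v (phi z - f.[z] / g.[z])%R)%E).

Definition in_Gamma0t (g : 'M[{poly F}]_2) : bool :=
  (g \in unitmx) && ('X %| g 1 0).

Definition slash (k : nat) (m : int) (phi : C -> C) (g : 'M[{poly F}]_2) (z : C) : C :=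
  let a := emb_poly (g 0 0) in let b := emb_poly (g 0 1) in
  let c := emb_poly (g 1 0) in let d := emb_poly (g 1 1) in
  phi ((a * z + b) / (c * z + d)) * emb_poly (\det g) ^ m * (c * z + d) ^- k.

(* The lattice of those b for which z |-> z + b lies in g^-1 Gamma_0(t) g. *)
Definition cusp_lattice (g : 'M[{poly F}]_2) (b : {poly F}) : bool :=
  in_Gamma0t (g *m (1%:M + b *: delta_mx 0 1) *m invmx g).

(* e = z \prod_(b <> 0 in the lattice) (1 - z / b), the inverse of the        *)
(* uniformizer at the cusp g(oo); rVpoly enumerates the polynomials of size   *)
(* at most N.                                                                 *)
Definition cusp_exp (g : 'M[{poly F}]_2) (z e : C) : Prop :=
  vconverges v (fun N => z *
    \prod_(r : 'rV[F]_N | (r != 0) && cusp_lattice g (rVpoly r))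
       (1 - z / emb_poly (rVpoly r))) e.

(* phi | g is a power series without constant term in u = 1 / e as soon as    *)
(* the distance of z to K_oo is large enough.                                 *)
Definition vanishes_at_cusp (k : nat) (m : int) (phi : C -> C)
    (g : 'M[{poly F}]_2) : Prop :=
  exists (a : nat -> C) (r : rat), a 0%N = 0 /\
    forall z : C, (forall x : Kinf C, (v (z - emb_Kinf x)%R <= r%:E)%E) ->
      exists e : C, cusp_exp g z e /\
        vconverges v (fun N => \sum_(i < N) a i * e ^- i) (slash k m phi g z).

(* Functions on Omega are represented by their extension by 0 to C.  As       *)
(* F[t] is principal, the cusps are the g(oo) with g in GL_2(F[t]).           *)
Record cusp_form (k : nat) (m : int) (phi : C -> C) : Prop := {
  cusp_form_supp : forall z, ~ Omega z -> phi z = 0;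
  cusp_form_analytic : rigid_analytic phi;
  cusp_form_modular : forall g z, in_Gamma0t g -> Omega z ->
    slash k m phi g z = phi z;
  cusp_form_cusps : forall g, g \in unitmx -> vanishes_at_cusp k m phi g
}.

Definition Ut (phi : C -> C) (z : C) : C :=
  \sum_(b : F) phi ((z + emb_poly b%:P) / emb_poly 'X).

End CuspForms.

Definition is_basis (T : Type) (C : fieldType) (V : (T -> C) -> Prop) (n : nat)
    (e : 'I_n -> T -> C) : Prop :=
  (forall i, V (e i)) /\
  forall f, V f -> exists! c : 'cV[C]_n, forall z, f z = \sum_i c i 0 * e i z.

Definition represents (T : Type) (C : fieldType) (U : (T -> C) -> T -> C) (n : nat)
    (e : 'I_n -> T -> C) (A : 'M[C]_n) : Prop :=
  forall i z, U (e i) z = \sum_l A l i * e l z.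

Definition is_char_poly (T : Type) (C : fieldType) (V : (T -> C) -> Prop)
    (U : (T -> C) -> T -> C) (P : {poly C}) : Prop :=
  exists (n : nat) (e : 'I_n -> T -> C) (A : 'M[C]_n),
    [/\ is_basis V e, represents U e A & P = char_poly A].

(* The matrix M D.  The indices a, b : 'I_n start at 0. *)
Definition mcoef (R : nzRingType) (q j n : nat) (a b : 'I_n) : R :=
  let x := (j + (n - a.+1) * q.-1)%N in
  if a == b then (-1) ^+ j * 'C(x, j + a * q.-1)%:R
  else - ('C(x, j + (n - b.+1) * q.-1)%:R
          + (-1) ^+ j.+1 * 'C(x, j + b * q.-1)%:R).

Definition Ut_matrix (F : finFieldType) (q j n : nat) : 'M[{poly F}]_n :=
  (\matrix_(a, b) (mcoef F q j a b)%:P)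
    *m diag_mx (\row_i 'X^(j + 1 + i * q.-1)).

Definition slope_mult (F : finFieldType) (L : tadic_closure F)
    (P : {poly {poly F}}) (alpha : rat) : nat :=
  count (fun x : L => aclos_val x == alpha%:E)
    (sval (closed_field_poly_normal (map_poly (tadic_emb L) P))).

Definition is_slope (F : finFieldType) (L : tadic_closure F)
    (P : {poly {poly F}}) (alpha : rat) : Prop :=
  (1 <= slope_mult L P alpha)%N.

(* Main.v *)
Require Import Defs.
From mathcomp Require Import all_boot all_order all_algebra.
From mathcomp Require Import constructive_ereal.
Import GRing.Theory Num.Theory.
Local Open Scope ring_scope.

(** Write U_t = t^(j+1) B, where B has entries in F_q[t] and only its first
    column survives modulo t.  The coefficient c_i of X^(n-i) in the
    characteristic polynomial then has t-adic valuation at least i(j+1), with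
    strict inequality for i >= 2.  On the other hand, if a is the least
    valuation of a root and d roots have valuation a, then v_t(c_d) = d a.
    Hence a >= j+1, and a = j+1 forces d <= 1. *)

Section Valuation.
Import Order.TTheory.
Variables (K : fieldType) (v : K -> \bar rat).
Hypothesis valv : is_valuation v.

Lemma val0 : v 0 = +oo%E.
Proof. by apply/eqP; rewrite (val_eqy valv). Qed.

Lemma val_fin x : x != 0 -> exists a, v x = a%:E.
Proof.
move=> x0; have := val_eqy valv x; have := val_neqNy valv x.
by case: (v x) => [a _ _||]; [exists a| rewrite (negPf x0) |].
Qed.

Lemma val1 : v 1 = 0%E.
Proof.
have [a va] := val_fin _ (oner_neq0 K).
have := Defs.valM valv 1 1; rewrite mulr1 va -EFinD => -[].
by move=> /esym/eqP; rewrite -subr_eq0 addrK => /eqP ->.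
Qed.

Lemma valN x : v (- x) = v x.
Proof.
suff vN1 : v (-1) = 0%E by rewrite -mulN1r (Defs.valM valv) vN1 add0e.
have N10 : -1 != 0 :> K by rewrite oppr_eq0 oner_neq0.
have [a va] := val_fin _ N10.
have := Defs.valM valv (-1) (-1); rewrite mulrNN mulr1 val1 va -EFinD => -[].
by move/esym/eqP; rewrite -mulr2n mulrn_eq0 /= => /eqP ->.
Qed.

Lemma val_addl x y : (v x < v y)%E -> v (x + y) = v x.
Proof.
move=> ltxy; apply/le_anti/andP; split; last first.
  by rewrite -{1}(min_idPl (ltW ltxy)) (valD valv).
have := valD valv (x + y) (- y); rewrite addrK valN ge_min.
by case/orP=> //; rewrite leNgt ltxy.
Qed.

Lemma val_coef_prod (a : rat) (s : seq K) :
  let p := \prod_(x <- s) ('X - x%:P) in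
  let d := count (fun x => v x == a%:E) s in
  all (fun x => (a%:E <= v x)%E) s ->
  forall i k, (i + k = size s)%N ->
  [/\ ((a *+ i)%:E <= v p`_k)%E,
      (d < i)%N -> ((a *+ i)%:E < v p`_k)%E
    & i = d -> v p`_k = (a *+ i)%:E].
Proof.
elim: s => [|x s IH] /=.
  move=> _ i k /eqP; rewrite addn_eq0 => /andP[/eqP-> /eqP->].
  by rewrite big_nil coef1 eqxx val1.
case/andP=> ax /IH {}IH i k ik; rewrite big_cons mulrBl coefB coefXM coefCM.
set p := \prod_(y <- s) _ in IH *; set d := count _ s in IH *.
have d_le : (d <= size s)%N by apply: count_size.
have vu : let u := if k == 0%N then 0 else p`_k.-1 in
  [/\ ((a *+ i)%:E <= v u)%E, (d < i)%N -> ((a *+ i)%:E < v u)%E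
    & i = d -> v u = (a *+ i)%:E].
  case: k ik => [|k] ik /=; last first.
    by apply: IH; move: ik; rewrite addnS => -[].
  rewrite val0 leey ltry; split=> // id_.
  by move: d_le; rewrite -id_ -[i]addn0 ik ltnn.
have vw : [/\ ((a *+ i)%:E <= v (x * p`_k))%E,
    ((v x == a%:E) + d < i)%N -> ((a *+ i)%:E < v (x * p`_k))%E,
    v x != a%:E -> (d < i)%N || (i == d) -> ((a *+ i)%:E < v (x * p`_k))%E
  & v x = a%:E -> i = d.+1 -> v (x * p`_k) = (a *+ i)%:E].
  case: i ik {vu} => [|i] ik.
    rewrite (_ : p`_k = 0) ?mulr0 ?val0 ?leey ?ltry //.
    by apply: nth_default; rewrite size_prod_XsubC -ik.
  have [le lt eq] : [/\ ((a *+ i)%:E <= v p`_k)%E,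
      (d < i)%N -> ((a *+ i)%:E < v p`_k)%E & i = d -> v p`_k = (a *+ i)%:E].
    by apply: IH; move: ik; rewrite addSn => -[].
  rewrite (Defs.valM valv) mulrS EFinD; split.
  - exact: leeD.
  - have [-> /lt|vx _] := eqVneq (v x) a%:E; first by rewrite lteD2lE.
    by rewrite lte_leD // lt_neqAle eq_sym vx.
  - by move=> vx _; rewrite lte_leD // lt_neqAle eq_sym vx.
  - by move=> -> [/eq ->].
case: vu; set u := (if _ then _ else _) => leu ltu equ.
case: vw; set w := x * _ => lew ltw ltw' eqw.
split.
- by apply: le_trans (valD valv _ _); rewrite valN le_min leu lew.
- move=> di; apply: lt_le_trans (valD valv _ _); rewrite valN lt_min ltw // andbT.
  by apply: ltu; apply: leq_ltn_trans di; rewrite leq_addl.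
- case: eqVneq ltw' eqw => [vx _ eqw|vx ltw' _] /= id_.
    rewrite addrC val_addl valN ?(eqw vx id_) //.
    by apply: ltu; rewrite id_.
  rewrite -(equ id_) val_addl // valN (equ id_).
  by apply: ltw' => //; rewrite id_ eqxx orbT.
Qed.

Lemma val_roots_ge_simple (b : rat) (s : seq K) :
    (forall i k, (i + k = size s)%N ->
      let c := (\prod_(x <- s) ('X - x%:P))`_k in
      ((b *+ i)%:E <= v c)%E /\ ((2 <= i)%N -> ((b *+ i)%:E < v c)%E)) ->
  (forall x, x \in s -> (b%:E <= v x)%E) /\
  (count (fun x => v x == b%:E) s <= 1)%N.
Proof.
move=> coef_s.
have ge_b x : x \in s -> (b%:E <= v x)%E.
  move=> xs; have [->|x0] := eqVneq x 0; first by rewrite val0 leey.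
  pose i0 : 'I_(size s) := Ordinal (etrans (index_mem x s) xs).
  case: (@arg_minP _ _ _ i0 predT (fun i : 'I__ => v s`_i)) => // i _ min_i.
  have le_x : (v s`_i <= v x)%E.
    by rewrite -[in X in (_ <= X)%E](nth_index 0 xs) (min_i i0).
  apply: le_trans le_x.
  have [-> |si0] := eqVneq s`_i 0; first by rewrite val0 leey.
  have [a va] := val_fin _ si0; rewrite va lee_fin.
  pose d := count (fun x => v x == a%:E) s.
  have d_gt0 : (0 < d)%N.
    by rewrite -has_count; apply/hasP; exists s`_i; rewrite ?mem_nth ?va.
  have a_min : all (fun y => (a%:E <= v y)%E) s.
    apply/(all_nthP 0) => l ls; rewrite -va; exact: (min_i (Ordinal ls)).
  have dk : (d + (size s - d) = size s)%N by rewrite subnKC // count_size.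
  have [_ _ /(_ erefl) vc] := val_coef_prod a s a_min _ _ dk.
  have [] := coef_s _ _ dk; rewrite vc lee_fin => + _.
  by rewrite lerMn2r eqn0Ngt d_gt0.
split=> //; set d := count _ s; rewrite leqNgt; apply/negP => d_gt1.
have dk : (d + (size s - d) = size s)%N by rewrite subnKC // count_size.
have b_min : all (fun y => (b%:E <= v y)%E) s by apply/allP.
have [_ _ /(_ erefl) vc] := val_coef_prod b s b_min _ _ dk.
by have [_ /(_ d_gt1)] := coef_s _ _ dk; rewrite vc ltxx.
Qed.

End Valuation.

Section CharPoly.
Variable R : comNzRingType.

Lemma char_poly_similar n (A B S T : 'M[R]_n) :
  T *m S = 1%:M -> A *m S = S *m B -> char_poly A = char_poly B.
Proof.
move=> TS AS; pose f := map_mx (@polyC R).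
have detTS : \det (f _ _ T) * \det (f _ _ S) = 1.
  by rewrite -det_mulmx -map_mxM TS map_mx1 det1.
have: char_poly A * \det (f _ _ S) = \det (f _ _ S) * char_poly B.
  rewrite /char_poly -!det_mulmx; congr (\det _).
  by rewrite mulmxBl mulmxBr -!map_mxM AS scalar_mxC.
move/(congr1 (fun x => x * \det (f _ _ T))).
by rewrite -mulrA mulrAC (mulrC (\det (f _ _ S))) detTS mulr1 mul1r.
Qed.

Lemma coef_comp_polyZX (c : R) (p : {poly R}) k :
  (p \Po (c *: 'X))`_k = c ^+ k * p`_k.
Proof.
rewrite coef_comp_poly.
under eq_bigr => i _ do rewrite exprZn coefZ coefXn.
have [kp|pk] := ltnP k (size p); last first.
  rewrite nth_default // mulr0 big1 // => i _.
  by rewrite gtn_eqF ?mulr0 // (leq_trans (ltn_ord i)).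
rewrite (bigD1 (Ordinal kp)) //= eqxx mulr1 mulrC big1 ?addr0 // => i ik.
by rewrite eq_sym (negPf (_ : (i != k :> nat))) ?mulr0.
Qed.

Lemma char_polyZ_comp n (c : R) (A : 'M[R]_n) :
  char_poly (c *: A) \Po (c *: 'X) = c ^+ n *: char_poly A.
Proof.
rewrite /char_poly -[RHS]mul_polyC polyC_exp -detZ -det_map_mx; congr (\det _).
apply/matrixP=> a b; rewrite !mxE rmorphB /= rmorphMn /= comp_polyX comp_polyC.
by rewrite mulrBr -polyCM mulrnAr mul_polyC.
Qed.

End CharPoly.

Lemma coef_char_polyZ (R : idomainType) n (c : R) (A : 'M[R]_n) i k :
  c != 0 -> (i + k = n)%N ->
  (char_poly (c *: A))`_k = c ^+ i * (char_poly A)`_k.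
Proof.
move=> c0 ik; apply: (mulfI (expf_neq0 k c0)).
rewrite -coef_comp_polyZX char_polyZ_comp coefZ mulrA -exprD.
by rewrite addnC ik.
Qed.

Lemma coef_char_poly_col0 (R : comNzRingType) n (A : 'M[R]_n) i k :
    (forall a b : 'I_n, (0 < b)%N -> A a b = 0) ->
  (i + k = n)%N -> (2 <= i)%N -> (char_poly A)`_k = 0.
Proof.
case: n A => [|n] A A0 ik i_gt1; first by case: i ik i_gt1.
have trigA : is_trig_mx A.
  by apply/is_trig_mxP => a b ab; apply: A0; apply: leq_ltn_trans ab.
rewrite (char_poly_trig trigA) big_ord_recl.
under eq_bigr => a _ do rewrite A0 // subr0.
rewrite prodr_const card_ord coefMXn ifT //.
by rewrite -ltnS -ik -[k.+1]add1n ltn_add2r.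
Qed.

Section UtMatrix.
Variable F : finFieldType.

Lemma Ut_matrix_scale q j n : (1 < q)%N ->
  exists2 B : 'M[{poly F}]_n, Ut_matrix F q j n = 'X^(j + 1) *: B
    & forall a b : 'I_n, (0 < b)%N -> 'X %| B a b.
Proof.
move=> q_gt1; exists (\matrix_(a, b) ((mcoef F q j a b)%:P * 'X^(b * q.-1))).
  by apply/matrixP=> a b; rewrite /Ut_matrix mul_mx_diag !mxE exprD mulrCA.
case: q q_gt1 => [|[|q]] // _ a b b_gt0; rewrite mxE dvdp_mull //.
by rewrite -[X in X %| _]expr1 dvdp_exp2l // muln_gt0 b_gt0.
Qed.

Lemma dvdp_coef_char_poly_Ut q j n i k : (1 < q)%N -> (i + k = n)%N ->
  'X^((j + 1) * i + (2 <= i)) %| (char_poly (Ut_matrix F q j n))`_k.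
Proof.
move=> q_gt1 ik; have [B -> BX] := Ut_matrix_scale q j n q_gt1.
rewrite (coef_char_polyZ _ _ _ _ _ _ _ ik) ?monic_neq0 ?monicXn //.
rewrite exprD -exprM dvdp_mul2l ?monic_neq0 ?monicXn //.
case: leqP => i_gt1; first by rewrite dvd1p.
rewrite expr1 -['X]subr0 dvdp_XsubCl; apply/rootP.
pose ev : {rmorphism {poly F} -> F} := horner_eval 0.
rewrite -[LHS]/(ev _) -coef_map /= map_char_poly.
apply: coef_char_poly_col0 ik i_gt1 => a b b_gt0; rewrite mxE.
by apply/rootP; rewrite -dvdp_XsubCl subr0; apply: BX.
Qed.

End UtMatrix.

Section Embeddings.
Context {F : finFieldType}.

(* Convertible to emb_poly and tadic_emb, which carry no morphism structure. *)
Definition emb_poly_rmorphism (C : Cinfty F) : {rmorphism {poly F} -> C} :=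
  compl_emb C \o aclos_emb (Kinfbar C) \o compl_emb (Kinf C)
    \o @FracField.tofrac _.

Definition tadic_emb_rmorphism (L : tadic_closure F) : {rmorphism {poly F} -> L} :=
  aclos_emb L \o compl_emb (Laurent L) \o @FracField.tofrac _.

Lemma emb_poly_inj (C : Cinfty F) : injective (@emb_poly F C).
Proof.
move=> x y /fmorph_inj/fmorph_inj/fmorph_inj/eqP.
by rewrite tofrac_eq => /eqP.
Qed.

Variable L : tadic_closure F.

Lemma val_tadic_emb (a : {poly F}) : a != 0 ->
  aclos_val (tadic_emb L a) = (mup 0 a)%:R%:E.
Proof.
move=> a0; rewrite /tadic_emb aclos_extends compl_extends /vt.
have := @frac_valE _ (fun a : {poly F} => (mup 0 a)%:Z) a 1.
rewrite tofrac1 divr1 => -> //; rewrite ?oner_neq0 //.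
  rewrite (_ : mup 0 1 = 0%N) ?subr0 //.
  by rewrite mupNroot ?root1.
by move=> x y x0 y0; rewrite mupM.
Qed.

Lemma dvdp_val_tadic_emb (a : {poly F}) N : 'X^N %| a ->
  (N%:R%:E <= aclos_val (tadic_emb L a))%E.
Proof.
have [-> _|a0 Xa] := eqVneq a 0.
  have -> : tadic_emb L 0 = 0 by apply: (rmorph0 (tadic_emb_rmorphism L)).
  by rewrite (val0 _ _ (aclos_valuation L)) leey.
rewrite val_tadic_emb // lee_fin ler_nat.
by rewrite mup_geq // subr0.
Qed.

End Embeddings.

Section Basis.
Variables (T : Type) (C : fieldType) (V : (T -> C) -> Prop).

Lemma basis_coef_inj n (e : 'I_n -> T -> C) (c c' : 'cV[C]_n) :
    is_basis V e ->
  (forall z, \sum_i c i 0 * e i z = \sum_i c' i 0 * e i z) -> c = c'.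
Proof.
case: n e c c' => [|n] e c c' [Ve eP] cc'; first by apply/matrixP => -[].
have [x [xE x_uniq]] := eP _ (Ve 0).
have e0E z : e 0 z = \sum_i (delta_mx 0 0 : 'cV[C]_n.+1) i 0 * e i z.
  rewrite (bigD1 0) //= mxE !eqxx mul1r big1 ?addr0 // => i i0.
  by rewrite mxE (negPf i0) mul0r.
suff: delta_mx 0 0 = delta_mx 0 0 + (c - c').
  by move/eqP; rewrite -subr_eq0 opprD addNKr oppr_eq0 subr_eq0 => /eqP.
rewrite -(x_uniq _ e0E); apply: x_uniq => z.
under eq_bigr => i _ do rewrite mxE mulrDl [(c - c') _ _]mxE [(- c') _ _]mxE mulrBl.
by rewrite big_split sumrB /= cc' subrr addr0 -xE.
Qed.

Lemma basis_change n n' (e : 'I_n -> T -> C) (e' : 'I_n' -> T -> C) :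
  is_basis V e -> is_basis V e' ->
  exists S : 'M[C]_(n, n'), forall i z, e' i z = \sum_l S l i * e l z.
Proof.
move=> [_ eP] [Ve' _].
have /fin_all_exists [c cP] i : exists c : 'cV[C]_n,
    forall z, e' i z = \sum_l c l 0 * e l z.
  by have [c [cE _]] := eP _ (Ve' i); exists c.
by exists (\matrix_(l, i) c i l 0) => i z; rewrite cP; apply: eq_bigr => l _; rewrite mxE.
Qed.

Lemma sum_basis_change n n' m (e : 'I_n -> T -> C) (e' : 'I_n' -> T -> C)
    (S : 'M[C]_(n, n')) (A : 'M[C]_(n', m)) i z :
    (forall i z, e' i z = \sum_l S l i * e l z) ->
  \sum_l A l i * e' l z = \sum_l (S *m A) l i * e l z.
Proof.
move=> eS; under eq_bigr => l _ do rewrite eS mulr_sumr.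
rewrite exchange_big; apply: eq_bigr => l _ /=.
by rewrite mxE mulr_suml; apply: eq_bigr => h _; rewrite mulrCA mulrA.
Qed.

Lemma basis_mx_inj n m (e : 'I_n -> T -> C) (A B : 'M[C]_(n, m)) :
    is_basis V e ->
    (forall i z, \sum_l A l i * e l z = \sum_l B l i * e l z) ->
  A = B.
Proof.
move=> be AB; apply/matrixP=> l i.
suff /matrixP/(_ l 0) : col i A = col i B by rewrite !mxE.
have colE (D : 'M_(n, m)) z : \sum_l col i D l 0 * e l z = \sum_l D l i * e l z.
  by apply: eq_bigr => h _; rewrite mxE.
by apply: (basis_coef_inj _ _ _ _ be) => z; rewrite !colE AB.
Qed.

Lemma basis_change_inv n n' (e : 'I_n -> T -> C) (e' : 'I_n' -> T -> C)
    (S : 'M[C]_(n, n')) (S' : 'M[C]_(n', n)) : is_basis V e ->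
    (forall i z, e' i z = \sum_l S l i * e l z) ->
    (forall i z, e i z = \sum_l S' l i * e' l z) ->
  S *m S' = 1%:M.
Proof.
move=> be eS eS'; apply: (basis_mx_inj _ _ _ _ _ be) => i z.
rewrite -(sum_basis_change _ _ _ e e') // -eS' (bigD1 i) //=.
rewrite mxE eqxx mul1r big1 ?addr0 // => l li.
by rewrite mxE (negPf li) mul0r.
Qed.

Lemma char_poly_basis (U : (T -> C) -> T -> C) n n'
    (e : 'I_n -> T -> C) (e' : 'I_n' -> T -> C) (A : 'M[C]_n) (A' : 'M[C]_n') :
    (forall N (c : 'I_N -> C) (g : 'I_N -> T -> C) f,
       (forall z, f z = \sum_l c l * g l z) ->
       forall z, U f z = \sum_l c l * U (g l) z) ->
    is_basis V e -> is_basis V e' -> represents U e A -> represents U e' A' ->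
  char_poly A = char_poly A'.
Proof.
move=> linU be be' UA UA'.
have [S eS] := basis_change _ _ _ _ be be'.
have [S' eS'] := basis_change _ _ _ _ be' be.
have SS' := basis_change_inv _ _ _ _ _ _ be eS eS'.
have S'S := basis_change_inv _ _ _ _ _ _ be' eS' eS.
have nn' : n = n'.
  by apply/eqP; rewrite eqn_leq (mulmx1_min SS') (mulmx1_min S'S).
subst n'; apply: (char_poly_similar _ _ _ _ S S' S'S).
apply: (basis_mx_inj _ _ _ _ _ be) => i z.
rewrite -(sum_basis_change _ _ _ _ (fun l => U (e l))) //.
by rewrite -(sum_basis_change _ _ _ e e') // -UA' (linU _ _ _ _ (eS i)).
Qed.

End Basis.

Lemma Ut_linear {F : finFieldType} (C : Cinfty F) N (c : 'I_N -> C)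
    (g : 'I_N -> C -> C) (f : C -> C) :
  (forall z, f z = \sum_l c l * g l z) ->
  forall z, Ut f z = \sum_l c l * Ut (g l) z.
Proof.
move=> fE z; rewrite /Ut; under eq_bigr => b _ do rewrite fE.
by rewrite exchange_big; apply: eq_bigr => l _ /=; rewrite mulr_sumr.
Qed.

(* UtE is the known description of U_t on cusp forms: the space has dimension *)
(* n and U_t has matrix M D in a suitable basis.                              *)
Theorem proposition6p2
  (p r q : nat) (p_prime : prime p) (r_gt0 : (0 < r)%N) (qE : q = (p ^ r)%N)
  (F : finFieldType) (cardF : #|F| = q)
  (C : Cinfty F) (L : tadic_closure F)
  (j n k : nat) (m : int)
  (j_le : (j <= q - 2)%N) (n_gt0 : (1 <= n)%N)
  (kE : k = (2 * j + 2 + (n - 1) * (q - 1))%N)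
  (mE : (m = (j + 1)%N%:Z %[mod (q - 1)%N%:Z])%Z)
  (UtE : exists e : 'I_n -> C -> C,
     is_basis (cusp_form k m) e /\
     represents Ut e (map_mx emb_poly (Ut_matrix F q j n)))
  (P : {poly {poly F}})
  (PE : is_char_poly (cusp_form k m) Ut (map_poly (@emb_poly F C) P)) :
  (forall alpha : rat, is_slope L P alpha -> (j + 1)%:R <= alpha) /\
  (slope_mult L P (j + 1)%:R <= 1)%N.
Proof.
have q_gt1 : (1 < q)%N by rewrite qE -[1%N](expn0 p) ltn_exp2l ?prime_gt1.
have PE' : P = char_poly (Ut_matrix F q j n).
  have [e [be Ue]] := UtE; have [n' [e' [A' [be' Ue' PA']]]] := PE.
  have emb0 : emb_poly (C := C) 0 = 0 by apply: (rmorph0 (emb_poly_rmorphism C)).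
  apply: (map_inj_poly (emb_poly_inj C) emb0).
  rewrite PA' -(char_poly_basis _ _ _ _ _ _ _ _ _ _ (Ut_linear C) be be' Ue Ue').
  exact: esym (map_char_poly (emb_poly_rmorphism C) _).
rewrite /is_slope /slope_mult; case: closed_field_poly_normal => s /=.
have mapP : map_poly (tadic_emb L) P
    = char_poly (map_mx (tadic_emb L) (Ut_matrix F q j n)).
  by rewrite PE' (map_char_poly (tadic_emb_rmorphism L)).
rewrite {2}mapP (monicP (char_poly_monic _)) scale1r => sE.
have size_s : size s = n.
  by apply: succn_inj; rewrite -(size_prod_XsubC s id) -sE mapP size_char_poly.
have [] := val_roots_ge_simple _ _ (aclos_valuation L) (j + 1)%:R s.
  move=> i l il /=; rewrite -sE (coef_map (tadic_emb_rmorphism L)) /=.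
  have ldiv : 'X^((j + 1) * i + (2 <= i)) %| P`_l.
    by rewrite PE'; apply: dvdp_coef_char_poly_Ut; rewrite // il.
  have := dvdp_val_tadic_emb L _ _ ldiv.
  rewrite natrD natrM mulr_natr => le_l; split.
    by apply: Order.POrderTheory.le_trans le_l; rewrite lee_fin lerDl ler0n.
  move=> i_gt1; apply: Order.POrderTheory.lt_le_trans le_l.
  by rewrite i_gt1 lte_fin ltrDl ltr01.
move=> ge_j le1; split=> // alpha; rewrite -has_count => /hasP[x xs /eqP vx].
by have := ge_j _ xs; rewrite vx lee_fin.
Qed.
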